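(* The Pareto capacity in order $n=3$ is $c_3=9$; that is, $\max_{A\in\mathbb{R}^{3\times 3}}|\Pi(A)|=9$.
   Context: Vector inequalities are componentwise. For $A\in\mathbb{R}^{n\times n}$, a real number $\lambda$ is a Pareto eigenvalue of $A$ if there is $x\in\mathbb{R}^n\setminus\{0\}$ with $x\ge 0$, $Ax-\lambda x\ge 0$ and $\langle x,Ax-\lambda x\rangle=0$. The set of Pareto eigenvalues is $\Pi(A)$, and the Pareto capacity of order $n$ is $c_n:=\max_{A\in\mathbb{R}^{n\times n}}|\Pi(A)|$. *)

(* Defs.v *)
From HB Require Import structures.
From mathcomp Require Import all_boot all_order all_algebra.
From mathcomp Require Import classical_sets functions cardinality reals.

Set Implicit Arguments.
Unset Strict Implicit.
Unset Printing Implicit Defensive.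

Import Order.TTheory GRing.Theory Num.Theory.
Local Open Scope classical_set_scope.
Local Open Scope ring_scope.

Definition vec_nonneg (R : realType) (n : nat) (x : 'cV[R]_n) : Prop :=
  forall i : 'I_n, 0 <= x i ord0.

Definition inner (R : realType) (n : nat) (x y : 'cV[R]_n) : R :=
  \sum_(i < n) x i ord0 * y i ord0.

Definition pareto_eigenvalue (R : realType) (n : nat) (A : 'M[R]_n) (l : R)
    : Prop :=
  exists x : 'cV[R]_n,
    [/\ x <> 0, vec_nonneg x, vec_nonneg (A *m x - l *: x)
      & inner x (A *m x - l *: x) = 0].

Definition pareto_spectrum (R : realType) (n : nat) (A : 'M[R]_n) : set R :=
  [set l | pareto_eigenvalue A l].

(* [c] is the maximum of [|Pi(A)|] over all real n x n matrices: the value is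
   attained, and it bounds every spectrum (in particular every spectrum is
   finite, since [B #<= `I_c] forces [B] to be finite). *)
Definition is_pareto_capacity (R : realType) (n c : nat) : Prop :=
  (exists A : 'M[R]_n, (pareto_spectrum A #= `I_c)%card) /\
  (forall A : 'M[R]_n, (pareto_spectrum A #<= `I_c)%card).

(* Main.v *)
(* A Pareto eigenvalue of [A] is an eigenvalue, with a positive eigenvector, of
   a principal submatrix [A_J] whose eigenvector also satisfies the inequalities
   of the rows outside [J].  Singletons [J] give at most 1 eigenvalue each,
   pairs at most 2 and the full index set at most 3, so at most 12 in all.
   A singleton [{i}] contributes only if the column [i] is nonnegative off the
   diagonal, and a pair [{i, j}] contributes twice only if
   [a_ij a_ji < 0].  If all singletons contribute then no pair does so twice, so
   the only total above 9 left is 10, in two cases.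
   With one singleton [{i}], all pairs contribute twice, so the row [i] is
   negative off the diagonal, which forbids the pair [{j, k}].  With two
   singletons [{i}] and [{j}], the pairs containing [k] contribute twice and
   the full index set three times; this is excluded by the sign of the
   characteristic polynomial at two points between which no eigenvalue with a
   positive eigenvector can lie. *)
Require Import Defs.
From mathcomp Require Import all_boot all_order all_algebra.
From mathcomp Require Import boolp classical_sets functions cardinality.
From mathcomp Require Import reals.
From mathcomp Require Import zify ring lra.

Set Implicit Arguments.
Unset Strict Implicit.
Unset Printing Implicit Defensive.

Import Order.TTheory GRing.Theory Num.Theory.
Local Open Scope classical_set_scope.
Local Open Scope ring_scope.

(** * Cardinalities and root counts through duplicate-free lists *)

(** An infinite set would contain [n.+1] distinct elements, against the bound; a finite one is
    listed by its elements. This reduces the upper bound to lists of eigenvalues. *)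
Lemma card_le_II_uniq (T : choiceType) (A : set T) (n : nat) :
  (forall s : seq T, uniq s -> {in s, forall x, A x} -> (size s <= n)%N) ->
  (A #<= `I_n)%card.
Proof.
move=> sizeA; have [Afin|/(@infinite_set_fset _ _ n.+1)[B BA]] :=
  pselect (finite_set A); last first.
  by rewrite ltnNge sizeA // => x /BA.
have [m Am] := Afin.
rewrite (card_le_eql Am) card_le_II -(card_fset_set Am).
by apply: sizeA => // x; rewrite in_fset_set // => /set_mem.
Qed.

(** The appended 1 is the leading coefficient, so the polynomial is nonzero of degree [size c]. *)
Lemma size_monic_roots (R : idomainType) (c s : seq R) :
  uniq s -> {in s, forall x, (Poly (rcons c 1)).[x] = 0} ->
  (size s <= size c)%N.
Proof.
move=> us cs; have pE : Poly (rcons c 1) = rcons c 1 :> seq R.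
  by rewrite (@PolyK _ 0) // last_rcons oner_eq0.
rewrite -ltnS -(size_rcons c 1) -pE; apply: max_poly_roots => //.
  by rewrite -size_poly_eq0 pE size_rcons.
by apply/allP => x /cs/eqP.
Qed.

Lemma two_of_count (T : eqType) (P : pred T) (s : seq T) :
  uniq s -> (1 < count P s)%N -> exists u v, [/\ u != v, P u & P v].
Proof.
move=> /(filter_uniq P); rewrite -size_filter.
have := filter_all P s.
case: (filter P s) => [|u [|v t]] //= /and3P[Pu Pv _].
by rewrite inE negb_or => /andP[/andP[uv _] _] _; exists u, v.
Qed.

Lemma three_of_count (T : eqType) (P : pred T) (s : seq T) :
  uniq s -> (2 < count P s)%N ->
  exists u v w, [/\ [/\ u != v, u != w & v != w], P u, P v & P w].
Proof.
move=> /(filter_uniq P); rewrite -size_filter.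
have := filter_all P s.
case: (filter P s) => [|u [|v [|w t]]] //= /and4P[Pu Pv Pw _].
rewrite !inE !negb_or => /and4P[/and3P[uv uw _] /andP[vw _] _ _] _.
by exists u, v, w.
Qed.

Local Notation o0 := (ord0 : 'I_3).
Local Notation o1 := (lift ord0 ord0 : 'I_3).
Local Notation o2 := (lift ord0 (lift ord0 ord0) : 'I_3).

Section RealField.
Variable R : realFieldType.
Implicit Types (a : 'I_3 -> 'I_3 -> R) (l x y z : R).

(** * Vieta formulas and the obstruction to three positive eigenvectors *)

(** Divided differences: each subtraction of two equations, divided by the difference of the roots,
    lowers the degree. *)
Lemma quadratic_three_roots (u v w l1 l2 l3 : R) :
  l1 != l2 -> l1 != l3 -> l2 != l3 ->
  u * l1 ^+ 2 + v * l1 + w = 0 -> u * l2 ^+ 2 + v * l2 + w = 0 ->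
  u * l3 ^+ 2 + v * l3 + w = 0 -> [/\ u = 0, v = 0 & w = 0].
Proof.
move=> n12 n13 n23 e1 e2 e3.
have d12 : u * (l1 + l2) + v = 0.
  apply: (mulfI (_ : l1 - l2 != 0)); first by rewrite subr_eq0.
  by rewrite mulr0 -[RHS](subrr 0) -{1}e1 -e2; ring.
have d13 : u * (l1 + l3) + v = 0.
  apply: (mulfI (_ : l1 - l3 != 0)); first by rewrite subr_eq0.
  by rewrite mulr0 -[RHS](subrr 0) -{1}e1 -e3; ring.
have u0 : u = 0.
  apply: (mulfI (_ : l2 - l3 != 0)); first by rewrite subr_eq0.
  by rewrite mulr0 -[RHS](subrr 0) -{1}d12 -d13; ring.
by move: d12 e1; rewrite u0 !mul0r !add0r => ->; rewrite mul0r add0r.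
Qed.

(** The cubic minus [(l - l1)(l - l2)(l - l3)] is a quadratic with three distinct roots, hence
    zero. *)
Lemma cubic_vieta (s m n l1 l2 l3 : R) :
  l1 != l2 -> l1 != l3 -> l2 != l3 ->
  {in [:: l1; l2; l3], forall l, l ^+ 3 - s * l ^+ 2 + m * l - n = 0} ->
  [/\ s = l1 + l2 + l3, m = l1 * l2 + l1 * l3 + l2 * l3 & n = l1 * l2 * l3].
Proof.
move=> n12 n13 n23 h.
have [||| hs hm hn] := @quadratic_three_roots (l1 + l2 + l3 - s)
  (m - (l1 * l2 + l1 * l3 + l2 * l3)) (l1 * l2 * l3 - n) _ _ _ n12 n13 n23.
- by rewrite -[RHS](h l1) ?inE ?eqxx ?orbT //; ring.
- by rewrite -[RHS](h l2) ?inE ?eqxx ?orbT //; ring.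
- by rewrite -[RHS](h l3) ?inE ?eqxx ?orbT //; ring.
by split; lra.
Qed.

(* [h] is the characteristic polynomial of [[p, b, -1], [d, q, -1], [f, g, 0]].
   With [al = q - b] and [be = p - d] it satisfies
   [h(al) h(be) = - (be - al)^2 Q(al) P(be)], where [P(t) = t^2 - p t + f] and
   [Q(t) = t^2 - q t + g], whereas an eigenvalue with a positive eigenvector
   never lies between [al] and [be].  If [al = be] then [al] is an eigenvalue,
   and a positive eigenvector for it would make it a double root of [h]. *)
Lemma no_three_positive_eigenvectors (p q b d f g l1 l2 l3 : R) :
  0 <= (p - d) ^+ 2 - p * (p - d) + f ->
  0 <= (q - b) ^+ 2 - q * (q - b) + g ->
  {in [:: l1; l2; l3], forall l, exists x y z, [/\ 0 < x, 0 < y &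
     [/\ p * x + b * y - z = l * x, d * x + q * y - z = l * y
       & f * x + g * y = l * z]]} ->
  ~ [/\ l1 != l2, l1 != l3 & l2 != l3].
Proof.
set al := q - b; set be := p - d => P_ge0 Q_ge0 ev [n12 n13 n23].
have chi : {in [:: l1; l2; l3], forall l, l ^+ 3 - (p + q) * l ^+ 2 +
    (p * q - b * d + f + g) * l - (f * al + g * be) = 0}.
  move=> l /ev[x [y [z [x0 y0 [e1 e2 e3]]]]].
  apply: (mulfI (lt0r_neq0 x0)); rewrite mulr0.
  (* Eliminating [z] leaves a 2x2 system in [x] and [y] whose determinant is the characteristic
     polynomial at [l]. *)
  have ez : z = (p - l) * x + b * y by lra.
  have e4 : (f - l * (p - l)) * x + (g - l * b) * y = 0.
    by move: e3; rewrite ez => e3; lra.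
  have e5 : (be - l) * x - (al - l) * y = 0 by rewrite /al /be; lra.
  transitivity (- (al - l) * ((f - l * (p - l)) * x + (g - l * b) * y)
    - (g - l * b) * ((be - l) * x - (al - l) * y)); last by rewrite e4 e5; ring.
  by rewrite /al /be; ring.
have [hs hm hn] := cubic_vieta n12 n13 n23 chi.
have [ab|nab] := eqVneq al be.
  have crit : (al - l1) * (al - l2) * (al - l3) = 0.
    transitivity (al ^+ 3 - (l1 + l2 + l3) * al ^+ 2 +
      (l1 * l2 + l1 * l3 + l2 * l3) * al - l1 * l2 * l3); first by ring.
    rewrite -hs -hm -hn -ab.
    have -> : p = be + d by rewrite /be; ring.
    have -> : q = al + b by rewrite /al; ring.
    by rewrite -ab; ring.
  (* The left-hand side is the derivative of [h] at [al]. The third row makes a positive combination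
     of [f - al * d] and [g - al * b] vanish; both are nonnegative, so both are 0. *)
  have double l : l \in [:: l1; l2; l3] -> al = l ->
      3 * al ^+ 2 - 2 * (l1 + l2 + l3) * al + (l1 * l2 + l1 * l3 + l2 * l3) = 0.
    move=> /ev[x [y [z [x0 y0 [e1 _ e3]]]]] al_l.
    rewrite -al_l in e1 e3.
    rewrite -hs -hm.
    have pE : p = al + d by rewrite ab /be; ring.
    have qE : q = al + b by rewrite /al; ring.
    have ez : z = d * x + b * y by move: e1; rewrite pE; lra.
    have fge : 0 <= f - al * d by move: P_ge0; rewrite -ab {1}pE; lra.
    have gge : 0 <= g - al * b by move: Q_ge0; rewrite {1}qE; lra.
    have sum0 : (f - al * d) * x + (g - al * b) * y = 0.
      by move: e3; rewrite ez; lra.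
    have fx : 0 <= (f - al * d) * x by rewrite mulr_ge0 // ltW.
    have gy : 0 <= (g - al * b) * y by rewrite mulr_ge0 // ltW.
    have fE : f - al * d = 0.
      by apply: (mulIf (lt0r_neq0 x0)); rewrite mul0r; lra.
    have gE : g - al * b = 0.
      by apply: (mulIf (lt0r_neq0 y0)); rewrite mul0r; lra.
    have -> : f = al * d by lra.
    have -> : g = al * b by lra.
    by rewrite pE qE; ring.
  (* At a root of [h], the derivative is the product of the differences to the other two roots. *)
  have nz (u v w : R) : u != v -> u != w -> (u - v) * (u - w) != 0.
    by move=> uv uw; apply: mulf_neq0; rewrite subr_eq0.
  move/eqP: crit; rewrite !mulf_eq0 !subr_eq0 -orbA => /or3P[]/eqP al_l.
  - move/eqP: (nz _ _ _ n12 n13); apply.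
    by rewrite -[RHS](double l1) ?inE ?eqxx // al_l; ring.
  - rewrite eq_sym in n12; move/eqP: (nz _ _ _ n12 n23); apply.
    by rewrite -[RHS](double l2) ?inE ?eqxx ?orbT // al_l; ring.
  - rewrite eq_sym in n13; rewrite eq_sym in n23; move/eqP: (nz _ _ _ n13 n23); apply.
    by rewrite -[RHS](double l3) ?inE ?eqxx ?orbT // al_l; ring.
have outside : {in [:: l1; l2; l3], forall l, 0 < (al - l) * (be - l)}.
  move=> l /ev[x [y [z [x0 y0 [e1 e2 _]]]]].
  (* The difference of the first two rows: as [x] and [y] are positive, [al - l] and [be - l] have
     the same sign. *)
  have e5 : (be - l) * x = (al - l) * y by rewrite /al /be; lra.
  have al_l : al - l != 0.
    apply: contraNneq nab => al0; move: e5; rewrite al0 mul0r => /eqP.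
    rewrite mulf_eq0 (gt_eqF x0) orbF => /eqP be0.
    by apply/eqP; lra.
  rewrite -(pmulr_lgt0 _ x0) -mulrA e5 mulrA -expr2 mulr_gt0 //.
  by rewrite exprn_even_gt0.
(* By the Vieta formulas this product is [h(al) h(be)]. *)
have : 0 < ((al - l1) * (be - l1)) * ((al - l2) * (be - l2)) *
    ((al - l3) * (be - l3)).
  by apply: mulr_gt0; [apply: mulr_gt0|]; apply: outside;
    rewrite !inE eqxx ?orbT.
rewrite ltNge => /negP; apply.
rewrite (_ : _ * _ = ((al ^+ 3 - (l1 + l2 + l3) * al ^+ 2 +
      (l1 * l2 + l1 * l3 + l2 * l3) * al - l1 * l2 * l3)) *
   ((be ^+ 3 - (l1 + l2 + l3) * be ^+ 2 +
      (l1 * l2 + l1 * l3 + l2 * l3) * be - l1 * l2 * l3))); last by ring.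
rewrite -hs -hm -hn.
rewrite (_ : _ * _ = - ((be - al) ^+ 2 * (al ^+ 2 - q * al + g) *
  (be ^+ 2 - p * be + f))); last by rewrite /al /be; ring.
by rewrite oppr_le0 mulr_ge0 // mulr_ge0 // sqr_ge0.
Qed.

(** * Eigenvalue types, by the support of the eigenvector *)

(** Support [{i}]: with the eigenvector scaled to 1, only column [i] remains. *)
Definition single_eigen a i j k l := [/\ l = a i i, 0 <= a j i & 0 <= a k i].

Definition pair_eigen a i j k l := exists x y, [/\ 0 < x, 0 < y,
  a i i * x + a i j * y = l * x, a j i * x + a j j * y = l * y
  & 0 <= a k i * x + a k j * y].

Definition triple_eigen a i j k l := exists x y z, [/\ 0 < x, 0 < y, 0 < z &
  [/\ a i i * x + a i j * y + a i k * z = l * x,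
      a j i * x + a j j * y + a j k * z = l * y
    & a k i * x + a k j * y + a k k * z = l * z]].

Lemma pair_eigenC a i j k : pair_eigen a i j k = pair_eigen a j i k.
Proof.
apply/funext => l; apply/propext.
by split=> -[x [y [x0 y0 e1 e2 e3]]]; exists y, x; split=> //; rewrite addrC.
Qed.

Lemma triple_eigenCl a i j k : triple_eigen a i j k = triple_eigen a j i k.
Proof.
apply/funext => l; apply/propext.
by split=> -[x [y [z [x0 y0 z0 [e1 e2 e3]]]]]; exists y, x, z; split=> //;
  split; lra.
Qed.

Lemma triple_eigenCr a i j k : triple_eigen a i j k = triple_eigen a i k j.
Proof.
apply/funext => l; apply/propext.
by split=> -[x [y [z [x0 y0 z0 [e1 e2 e3]]]]]; exists x, z, y; split=> //;
  split; rewrite addrAC.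
Qed.

Lemma pair_eigen_quadratic a i j k l : pair_eigen a i j k l ->
  l ^+ 2 - (a i i + a j j) * l + (a i i * a j j - a i j * a j i) = 0.
Proof.
move=> [x [y [x0 y0 e1 e2 _]]].
apply: (mulfI (lt0r_neq0 x0)); rewrite mulr0.
have f1 : (a i i - l) * x + a i j * y = 0 by lra.
have f2 : a j i * x + (a j j - l) * y = 0 by lra.
transitivity ((a j j - l) * ((a i i - l) * x + a i j * y) -
  a i j * (a j i * x + (a j j - l) * y)); last by rewrite f1 f2; ring.
by ring.
Qed.

Lemma pair_eigen_vieta a i j k l m : l != m ->
  pair_eigen a i j k l -> pair_eigen a i j k m ->
  l + m = a i i + a j j /\ l * m = a i i * a j j - a i j * a j i.
Proof.
move=> lm /pair_eigen_quadratic el /pair_eigen_quadratic em.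
have s : l + m = a i i + a j j.
  apply: (mulfI (_ : l - m != 0)); first by rewrite subr_eq0.
  by apply/eqP; rewrite -subr_eq0 -(subrr 0) -{1}el -em; apply/eqP; ring.
by split=> //; move: el; rewrite -s => el; lra.
Qed.

(** By Vieta, [a i j * a j i = - (l - a i i)(m - a i i)], and row [i] at a positive eigenvector
    gives both factors the sign of [a i j]. If [a i j] were 0, then [l = m = a i i]. *)
Lemma pair_eigen_opposite_signs a i j k l m : l != m ->
  pair_eigen a i j k l -> pair_eigen a i j k m -> a i j * a j i < 0.
Proof.
move=> lm pl pm; have [s p] := pair_eigen_vieta lm pl pm.
have e : a i j * a j i = - ((l - a i i) * (m - a i i)).
  have -> : a i j * a j i = a i i * a j j - l * m by lra.
  have -> : a j j = l + m - a i i by lra.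
  by ring.
rewrite e oppr_lt0.
have [x [y [x0 y0 e1 _ _]]] := pl; have [u [v [u0 v0 f1 _ _]]] := pm.
have xE : (l - a i i) * x = a i j * y by lra.
have uE : (m - a i i) * u = a i j * v by lra.
have nz : a i j != 0.
  apply: contra lm => /eqP b0; move: xE uE; rewrite b0 !mul0r => /eqP + /eqP.
  by rewrite !mulf_eq0 (gt_eqF x0) (gt_eqF u0) !orbF !subr_eq0 => /eqP -> /eqP ->.
rewrite -(pmulr_lgt0 _ (mulr_gt0 x0 u0)) mulrACA xE uE mulrACA.
by apply: mulr_gt0; [rewrite -expr2 exprn_even_gt0 | apply: mulr_gt0].
Qed.

Lemma triple_eigen_cubic a i j k l : triple_eigen a i j k l ->
  l ^+ 3 - (a i i + a j j + a k k) * l ^+ 2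
  + (a i i * a j j - a i j * a j i + (a i i * a k k - a i k * a k i)
     + (a j j * a k k - a j k * a k j)) * l
  - (a i i * (a j j * a k k - a j k * a k j)
     - a i j * (a j i * a k k - a j k * a k i)
     + a i k * (a j i * a k j - a j j * a k i)) = 0.
Proof.
move=> [x [y [z [x0 y0 z0 [e1 e2 e3]]]]].
apply: (mulfI (lt0r_neq0 x0)); rewrite mulr0.
have f1 : (l - a i i) * x - a i j * y - a i k * z = 0 by lra.
have f2 : - a j i * x + (l - a j j) * y - a j k * z = 0 by lra.
have f3 : - a k i * x - a k j * y + (l - a k k) * z = 0 by lra.
(* The multipliers are the cofactors of the first column of [l - A], so the sum is the determinant
   times [x]. *)
transitivity (
  ((l - a j j) * (l - a k k) - a j k * a k j) *
    ((l - a i i) * x - a i j * y - a i k * z)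
  + (a i j * (l - a k k) + a i k * a k j) *
    (- a j i * x + (l - a j j) * y - a j k * z)
  + (a i j * a j k + a i k * (l - a j j)) *
    (- a k i * x - a k j * y + (l - a k k) * z)); last by rewrite f1 f2 f3; ring.
by ring.
Qed.

Lemma single_eigen_uniq a i j k (s : seq R) : uniq s ->
  {in s, forall l, single_eigen a i j k l} -> (size s <= 1)%N.
Proof.
case: s => [|u [|v s]] //= /andP[+ _] h.
have [-> _ _] := h u (mem_head _ _).
have [|-> _ _] := h v; first by rewrite !inE eqxx orbT.
by rewrite mem_head.
Qed.

Lemma pair_eigen_uniq a i j k (s : seq R) : uniq s ->
  {in s, forall l, pair_eigen a i j k l} -> (size s <= 2)%N.
Proof.
move=> us h; set c0 := a i i * a j j - a i j * a j i.
apply: (@size_monic_roots _ [:: c0; - (a i i + a j j)]) us _.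
move=> l /h/pair_eigen_quadratic e; rewrite horner_Poly /= -[RHS]e.
by rewrite /c0; ring.
Qed.

Lemma triple_eigen_uniq a i j k (s : seq R) : uniq s ->
  {in s, forall l, triple_eigen a i j k l} -> (size s <= 3)%N.
Proof.
move=> us h.
set c0 := a i i * (a j j * a k k - a j k * a k j)
     - a i j * (a j i * a k k - a j k * a k i)
     + a i k * (a j i * a k j - a j j * a k i).
set c1 := a i i * a j j - a i j * a j i + (a i i * a k k - a i k * a k i)
     + (a j j * a k k - a j k * a k j).
set c2 := a i i + a j j + a k k.
apply: (@size_monic_roots _ [:: - c0; c1; - c2]) us _.
move=> l /h/triple_eigen_cubic; rewrite -/c0 -/c1 -/c2 => e.
by rewrite horner_Poly /= -[RHS]e; ring.
Qed.

(** * Incompatibilities between the types *)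

Lemma two_singles_one_pair a i j k l1 l2 m1 m2 :
  single_eigen a i j k l1 -> single_eigen a j i k l2 -> m1 != m2 ->
  pair_eigen a i j k m1 -> ~ pair_eigen a i j k m2.
Proof.
move=> [_ ji _] [_ ij _] m12 p1 p2.
have := pair_eigen_opposite_signs m12 p1 p2.
by rewrite ltNge mulr_ge0.
Qed.

Lemma single_pair_neg a i j k l m1 m2 : single_eigen a i j k l -> m1 != m2 ->
  pair_eigen a i j k m1 -> pair_eigen a i j k m2 -> a i j < 0.
Proof.
move=> [_ ji _] m12 p1 p2; have := pair_eigen_opposite_signs m12 p1 p2.
by rewrite !ltNge; apply: contra => ij; rewrite mulr_ge0.
Qed.

Lemma single_two_pairs a i j k l m1 m2 n1 n2 r :
  single_eigen a i j k l -> m1 != m2 -> n1 != n2 ->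
  pair_eigen a i j k m1 -> pair_eigen a i j k m2 ->
  pair_eigen a i k j n1 -> pair_eigen a i k j n2 -> ~ pair_eigen a j k i r.
Proof.
move=> sl m12 n12 p1 p2 q1 q2 [x [y [x0 y0 _ _]]].
have ij := single_pair_neg sl m12 p1 p2.
have ik : a i k < 0.
  by apply: (single_pair_neg _ n12 q1 q2); case: sl => ? ? ?; split; eassumption.
by rewrite leNgt ltr_wnDl // ?nmulr_rlt0 // ltW // nmulr_rlt0.
Qed.

(** Supplies the two sign hypotheses of [no_three_positive_eigenvectors]. The quadratic
    [t^2 - p t - a i k * a k i] has roots [m1 - a k k] and [m2 - a k k], and the inequality of row
    [j] places both at or above [p - d], so its value there is nonnegative. *)
Lemma pair_eigen_condition a i j k m1 m2 (F : R) : a i k < 0 -> F = - a j k ->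
  m1 != m2 -> pair_eigen a i k j m1 -> pair_eigen a i k j m2 ->
  let p := a i i - a k k in let d := a j i * - a i k / F in
  0 < F -> 0 <= (p - d) ^+ 2 - p * (p - d) + a k i * - a i k.
Proof.
move=> ik FE m12 p1 p2 p d F0.
have [s q] := pair_eigen_vieta m12 p1 p2.
have below m : pair_eigen a i k j m -> 0 <= m - a k k - (p - d).
  move=> [x [z [x0 z0 e1 _ e3]]].
  (* Scaled by [F * x], the claim is the inequality of row [j] times [- a i k]. *)
  rewrite -(pmulr_rge0 _ x0) -(pmulr_rge0 _ F0).
  have -> : F * (x * (m - a k k - (p - d))) =
      F * (m * x - a i i * x) + (d * F) * x by rewrite /p; ring.
  rewrite /d divfK ?gt_eqF // -e1.
  have -> : F * (a i i * x + a i k * z - a i i * x) + a j i * - a i k * x =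
      - a i k * (a j i * x - F * z) by ring.
  by rewrite FE [- a j k * z]mulNr opprK mulr_ge0 // oppr_ge0 ltW.
have -> : (p - d) ^+ 2 - p * (p - d) + a k i * - a i k =
  (m1 - a k k - (p - d)) * (m2 - a k k - (p - d)).
  have -> : a k i * - a i k = m1 * m2 - a i i * a k k by lra.
  have -> : p = m1 + m2 - 2 * a k k by rewrite /p; lra.
  have -> : a i i = m1 + m2 - a k k by lra.
  by ring.
by rewrite mulr_ge0 ?below.
Qed.

(* Conjugating by [diag(-a i k, -a j k, 1)] and subtracting [a k k] puts the
   matrix in the form of [no_three_positive_eigenvectors]. *)
Lemma two_singles_two_pairs_triple a i j k l1 l2 m1 m2 n1 n2 t1 t2 t3 :
  single_eigen a i j k l1 -> single_eigen a j i k l2 ->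
  m1 != m2 -> pair_eigen a i k j m1 -> pair_eigen a i k j m2 ->
  n1 != n2 -> pair_eigen a j k i n1 -> pair_eigen a j k i n2 ->
  [/\ t1 != t2, t1 != t3 & t2 != t3] ->
  ~ {in [:: t1; t2; t3], forall t, triple_eigen a i j k t}.
Proof.
move=> s1 s2 m12 p1 p2 n12 q1 q2 t_neq ht.
have ik : a i k < 0.
  by apply: (single_pair_neg _ m12 p1 p2); case: s1 => ? ? ?; split; eassumption.
have jk : a j k < 0.
  by apply: (single_pair_neg _ n12 q1 q2); case: s2 => ? ? ?; split; eassumption.
have C0 : 0 < - a i k by rewrite oppr_gt0.
have F0 : 0 < - a j k by rewrite oppr_gt0.
have P := pair_eigen_condition ik erefl m12 p1 p2 F0.
have Q := pair_eigen_condition jk erefl n12 q1 q2 C0.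
apply: (no_three_positive_eigenvectors (l1 := t1 - a k k) (l2 := t2 - a k k)
  (l3 := t3 - a k k) P Q); last first.
  by rewrite !(inj_eq (addIr _)).
have shift : {in [:: t1; t2; t3], forall t, exists x y z, [/\ 0 < x, 0 < y &
     [/\ (a i i - a k k) * x + a i j * - a j k / - a i k * y - z
           = (t - a k k) * x,
         a j i * - a i k / - a j k * x + (a j j - a k k) * y - z
           = (t - a k k) * y
       & a k i * - a i k * x + a k j * - a j k * y = (t - a k k) * z]]}.
  move=> t /ht[x [y [z [x0 y0 z0 [e1 e2 e3]]]]].
  exists (x / - a i k), (y / - a j k), z; split; [exact: divr_gt0..|].
  have C1 : a i k != 0 by rewrite lt_eqF.
  have F1 : a j k != 0 by rewrite lt_eqF.
  split.
  - apply: (mulIf (lt0r_neq0 C0)).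
    transitivity (a i i * x + a i j * y + a i k * z - a k k * x).
      by field; rewrite C1 F1.
    by rewrite e1; field.
  - apply: (mulIf (lt0r_neq0 F0)).
    transitivity (a j i * x + a j j * y + a j k * z - a k k * y).
      by field; rewrite C1 F1.
    by rewrite e2; field.
  - transitivity (a k i * x + a k j * y + a k k * z - a k k * z).
      by field; rewrite C1 F1.
    by rewrite e3; ring.
move=> l; rewrite !inE => /or3P[]/eqP ->; apply: shift;
  by rewrite !inE eqxx ?orbT.
Qed.

(** * Counting the types: the bound 9 *)

(** The premises only ask whether each [s] is positive and each [p] exceeds 1; deciding these six
    questions leaves linear arithmetic. *)
Lemma type_counts_le9 (s0 s1 s2 p01 p02 p12 t : nat) :
  (s0 <= 1 -> s1 <= 1 -> s2 <= 1 -> p01 <= 2 -> p02 <= 2 -> p12 <= 2 ->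
  t <= 3 ->
  (0 < s0 -> 0 < s1 -> p01 <= 1) ->
  (0 < s0 -> 0 < s2 -> p02 <= 1) ->
  (0 < s1 -> 0 < s2 -> p12 <= 1) ->
  (0 < s0 -> 1 < p01 -> 1 < p02 -> p12 = 0) ->
  (0 < s1 -> 1 < p01 -> 1 < p12 -> p02 = 0) ->
  (0 < s2 -> 1 < p02 -> 1 < p12 -> p01 = 0) ->
  (0 < s0 -> 0 < s1 -> 1 < p02 -> 1 < p12 -> t <= 2) ->
  (0 < s0 -> 0 < s2 -> 1 < p01 -> 1 < p12 -> t <= 2) ->
  (0 < s1 -> 0 < s2 -> 1 < p01 -> 1 < p02 -> t <= 2) ->
  s0 + s1 + s2 + (p01 + p02 + p12) + t <= 9)%N.
Proof.
move=> ? ? ? ? ? ? ? ? ? ? ? ? ? ? ? ?.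
have [?|?] := posnP s0; have [?|?] := posnP s1; have [?|?] := posnP s2;
have [?|?] := leqP p01 1; have [?|?] := leqP p02 1; have [?|?] := leqP p12 1;
repeat match goal with
  | H : is_true ?P -> _, K : is_true ?P |- _ => specialize (H K)
  end;
repeat match goal with H : is_true _ -> _ |- _ => clear H end; lia.
Qed.

Lemma size_eigen_le9 a (s : seq R) : uniq s ->
  {in s, forall l,
    [\/ [\/ single_eigen a o0 o1 o2 l, single_eigen a o1 o0 o2 l
          | single_eigen a o2 o0 o1 l],
        [\/ pair_eigen a o0 o1 o2 l, pair_eigen a o0 o2 o1 l
          | pair_eigen a o1 o2 o0 l]
      | triple_eigen a o0 o1 o2 l]} ->
  (size s <= 9)%N.
Proof.
move=> us types.
(* Counts the entries of [s] of a given type; an entry of several types is counted once for each. *)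
pose N (P : R -> Prop) := count (fun l => `[< P l >]) s.
have N_le (P : R -> Prop) n : (forall t : seq R, uniq t ->
    {in t, forall l, P l} -> (size t <= n)%N) -> (N P <= n)%N.
  rewrite /N -size_filter; apply; first exact: filter_uniq.
  by move=> l; rewrite mem_filter => /andP[/asboolP].
have N1 (P : R -> Prop) : (0 < N P)%N -> exists l, P l.
  by rewrite /N -has_count => /hasP[l _ /asboolP]; exists l.
have N2 (P : R -> Prop) : (1 < N P)%N -> exists l m, [/\ l != m, P l & P m].
  by move=> /(two_of_count us)[l [m [lm /asboolP Pl /asboolP Pm]]]; exists l, m.
have N3 (P : R -> Prop) : (2 < N P)%N -> exists l m n,
    [/\ l != m, l != n & m != n] /\ {in [:: l; m; n], forall t, P t}.
  move=> /(three_of_count us)[l [m [n [d /asboolP Pl /asboolP Pm /asboolP Pn]]]].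
  exists l, m, n; split=> // t.
  by rewrite !inE => /or3P[]/eqP ->.
have S1 i j k : (N (single_eigen a i j k) <= 1)%N.
  by apply: N_le => t; apply: single_eigen_uniq.
have P2 i j k : (N (pair_eigen a i j k) <= 2)%N.
  by apply: N_le => t; apply: pair_eigen_uniq.
have T3 i j k : (N (triple_eigen a i j k) <= 3)%N.
  by apply: N_le => t; apply: triple_eigen_uniq.
have SC i j k : single_eigen a i j k = single_eigen a i k j.
  by apply/funext => l; apply/propext; split=> -[? ? ?]; split.
have F0 i j k : (0 < N (single_eigen a i j k))%N ->
    (0 < N (single_eigen a j i k))%N -> (N (pair_eigen a i j k) <= 1)%N.
  move=> /N1[l1 h1] /N1[l2 h2]; rewrite leqNgt; apply/negP => /N2[m1 [m2 [d p q]]].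
  exact: two_singles_one_pair h1 h2 d p q.
have F1 i j k : (0 < N (single_eigen a i j k))%N ->
    (1 < N (pair_eigen a i j k))%N -> (1 < N (pair_eigen a i k j))%N ->
    N (pair_eigen a j k i) = 0%N.
  move=> /N1[l1 h1] /N2[m1 [m2 [d p q]]] /N2[n1 [n2 [e p' q']]].
  apply/eqP; rewrite -leqn0 leqNgt; apply/negP => /N1[r].
  exact: single_two_pairs h1 d e p q p' q'.
have F2 i j k : (0 < N (single_eigen a i j k))%N ->
    (0 < N (single_eigen a j i k))%N ->
    (1 < N (pair_eigen a i k j))%N -> (1 < N (pair_eigen a j k i))%N ->
    (N (triple_eigen a i j k) <= 2)%N.
  move=> /N1[l1 h1] /N1[l2 h2] /N2[m1 [m2 [d p q]]] /N2[n1 [n2 [e p' q']]].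
  rewrite leqNgt; apply/negP => /N3[t1 [t2 [t3 [dt]]]].
  exact: two_singles_two_pairs_triple h1 h2 d p q e p' q' dt.
have : (size s <= N (single_eigen a o0 o1 o2) + N (single_eigen a o1 o0 o2) +
    N (single_eigen a o2 o0 o1) + (N (pair_eigen a o0 o1 o2) +
    N (pair_eigen a o0 o2 o1) + N (pair_eigen a o1 o2 o0)) +
    N (triple_eigen a o0 o1 o2))%N.
  rewrite /N {us N1 N2 N3 S1 P2 T3 F0 F1 F2 N_le}.
  elim: s types @N => //= l s IH types.
  have {}IH := IH (fun m ms => types m (@mem_behead _ (l :: s) m ms)).
  have : (0 < `[< single_eigen a o0 o1 o2 l >] + `[< single_eigen a o1 o0 o2 l >]
    + `[< single_eigen a o2 o0 o1 l >] + (`[< pair_eigen a o0 o1 o2 l >] +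
     `[< pair_eigen a o0 o2 o1 l >] + `[< pair_eigen a o1 o2 o0 l >]) +
     `[< triple_eigen a o0 o1 o2 l >])%N.
    by have [[]|[]|] := types l (mem_head _ _); move=> /asboolP ->; rewrite ?addnS.
  by lia.
have := (F0 o0 o1 o2, F0 o0 o2 o1, F0 o1 o2 o0).
have := (F1 o0 o1 o2, F1 o1 o0 o2, F1 o2 o0 o1).
have := (F2 o0 o1 o2, F2 o0 o2 o1, F2 o1 o2 o0).
(* The symmetries bring every instance to the index order of the seven counts. *)
rewrite !(pair_eigenC _ o1 o0) !(pair_eigenC _ o2 _).
rewrite (triple_eigenCr _ o0 o2) (triple_eigenCr _ o1 o2) (triple_eigenCl _ o1 o0).
rewrite !(SC o0 o2) !(SC o1 o2) !(SC o2 o1).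
have := (P2 o0 o1 o2, P2 o0 o2 o1, P2 o1 o2 o0).
move=> [[p1 p2] p3] [[f1 f2] f3] [[g1 g2] g3] [[h1 h2] h3] /leq_trans; apply.
exact: type_counts_le9 (S1 _ _ _) (S1 _ _ _) (S1 _ _ _) p1 p2 p3 (T3 _ _ _)
  h1 h2 h3 g1 g2 g3 f1 f2 f3.
Qed.

End RealField.

(** * From Pareto eigenvalues to the types *)

(** The inner product is a sum of nonnegative terms, so it vanishes exactly when each term does. *)
Lemma pareto_eigenvalue3P (R : realType) (A : 'M[R]_3) (l : R) :
  pareto_eigenvalue A l <-> exists x y z,
    let u := A o0 o0 * x + A o0 o1 * y + A o0 o2 * z - l * x in
    let v := A o1 o0 * x + A o1 o1 * y + A o1 o2 * z - l * y in
    let w := A o2 o0 * x + A o2 o1 * y + A o2 o2 * z - l * z in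
    [/\ ~ [/\ x = 0, y = 0 & z = 0], [/\ 0 <= x, 0 <= y & 0 <= z],
      [/\ 0 <= u, 0 <= v & 0 <= w] & [/\ x * u = 0, y * v = 0 & z * w = 0]].
Proof.
have ord3 (P : 'I_3 -> Prop) : P o0 -> P o1 -> P o2 -> forall i, P i.
  move=> P0 P1 P2 i; case: (unliftP ord0 i) => [j ->|->] //.
  case: (unliftP ord0 j) => [k ->|->] //.
  by rewrite (ord1 k).
have entry (x : 'cV[R]_3) i : (A *m x - l *: x) i ord0 =
    A i o0 * x o0 ord0 + A i o1 * x o1 ord0 + A i o2 * x o2 ord0 - l * x i ord0.
  by rewrite !mxE !big_ord_recl big_ord0 addr0 addrA.
split=> [[x [xn0 x_ge0 w_ge0 inner0]] | [x [y [z]]] /=].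
  exists (x o0 ord0), (x o1 ord0), (x o2 ord0); rewrite -!entry; split=> //.
  - move=> [e0 e1 e2]; apply: xn0; apply/matrixP => i j; rewrite (ord1 j) mxE.
    by move: i; apply: ord3.
  - have := psumr_eq0P (fun i _ => mulr_ge0 (x_ge0 i) (w_ge0 i)) inner0.
    by move=> h; split; apply: h.
move=> [xyz0 [x0 y0 z0] [u0 v0 w0] [xu yv zw]].
exists (\col_i tnth [tuple x; y; z] i); split.
- move=> /matrixP e; apply: xyz0.
  by move: (e o0 ord0) (e o1 ord0) (e o2 ord0); rewrite !mxE /= !(tnth_nth 0).
- by apply: ord3; rewrite !mxE !(tnth_nth 0).
- by apply: ord3; rewrite entry !mxE !(tnth_nth 0).
rewrite /inner !big_ord_recl big_ord0 !entry !mxE !(tnth_nth 0) /=.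
by rewrite xu yv zw !addr0.
Qed.

(** Case split on the support of the vector: complementarity turns the rows in the support into
    equations, and the other rows stay inequalities. *)
Lemma pareto_eigenvalue3_types (R : realType) (A : 'M[R]_3) (l : R) :
  pareto_eigenvalue A l ->
  [\/ [\/ single_eigen A o0 o1 o2 l, single_eigen A o1 o0 o2 l
        | single_eigen A o2 o0 o1 l],
      [\/ pair_eigen A o0 o1 o2 l, pair_eigen A o0 o2 o1 l
        | pair_eigen A o1 o2 o0 l]
    | triple_eigen A o0 o1 o2 l].
Proof.
move=> /pareto_eigenvalue3P[x [y [z]]] /=.
have cancel (t w : R) : 0 < t -> t * w = 0 -> w = 0.
  by move=> t0 /eqP; rewrite mulf_eq0 gt_eqF //= => /eqP.
have zero_or_pos (t : R) : 0 <= t -> t = 0 \/ 0 < t.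
  by rewrite le_eqVlt => /predU1P[<-|]; [left|right].
have single i (t : R) : 0 < t -> A i i * t - l * t = 0 -> l = A i i.
  by move=> t0 e; apply: (mulIf (lt0r_neq0 t0)); lra.
have div_ge0 (t w : R) : 0 < t -> 0 <= w * t -> 0 <= w.
  by move=> t0; rewrite pmulr_lge0.
move=> [nz [/zero_or_pos x0 /zero_or_pos y0 /zero_or_pos z0] [u0 v0 w0] [xu yv zw]].
case: x0 => x0; case: y0 => y0; case: z0 => z0;
  rewrite ?x0 ?y0 ?z0 ?mulr0 ?subr0 ?addr0 ?add0r in u0 v0 w0 xu yv zw.
- by case: nz.
- by apply: Or31; apply: Or33; split; [apply: (single _ z) => //; apply: cancel zw|
    apply: div_ge0 u0|apply: div_ge0 v0].
- by apply: Or31; apply: Or32; split; [apply: (single _ y) => //; apply: cancel yv|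
    apply: div_ge0 u0|apply: div_ge0 w0].
- apply: Or32; apply: Or33; exists y, z.
  by move/(cancel _ _ y0): yv; move/(cancel _ _ z0): zw; split=> //; lra.
- by apply: Or31; apply: Or31; split; [apply: (single _ x) => //; apply: cancel xu|
    apply: div_ge0 v0|apply: div_ge0 w0].
- apply: Or32; apply: Or32; exists x, z.
  by move/(cancel _ _ x0): xu; move/(cancel _ _ z0): zw; split=> //; lra.
- apply: Or32; apply: Or31; exists x, y.
  by move/(cancel _ _ x0): xu; move/(cancel _ _ y0): yv; split=> //; lra.
- apply: Or33; exists x, y, z.
  move/(cancel _ _ x0): xu; move/(cancel _ _ y0): yv; move/(cancel _ _ z0): zw.
  by split=> //; split; lra.
Qed.

Lemma pareto_spectrum3_card_le (R : realType) (A : 'M[R]_3) :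
  (pareto_spectrum A #<= `I_9)%card.
Proof.
apply: card_le_II_uniq => s us sA; apply: (@size_eigen_le9 R A s us) => l /sA.
exact: pareto_eigenvalue3_types.
Qed.

(** * A matrix with nine Pareto eigenvalues *)

(** Two singletons give 9 and 5, their pair gives 13, the pairs with the last index give 3, 6 and 1,
    4, and the full set gives 2 and 11: one less than the excluded total of 10. *)
Definition extremal_matrix (R : realType) : 'M[R]_3 :=
  \matrix_(i, j)
    nth 0 (nth [::] [:: [:: 9; 4; -1]; [:: 8; 5; -1]; [:: 18; 4; 0]] i) j.

Lemma II9_le_extremal_spectrum (R : realType) :
  (`I_9 #<= pareto_spectrum (extremal_matrix R))%card.
Proof.
pose f (n : nat) : R := (nth 0 [:: 1; 2; 3; 4; 5; 6; 9; 11; 13] n)%:R.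
have f_inj : {in `I_9 &, injective f}.
  move=> m n /set_mem /= m9 /set_mem /= n9 /eqP; rewrite eqr_nat.
  by rewrite nth_uniq // => /eqP.
rewrite -(card_le_eql (inj_card_eq f_inj)); apply: subset_card_le.
(* Natural coordinates make the vector nonnegative at once and leave numerical goals. *)
have evec (l x y z : nat) :
    let u : R := 9 * x%:R + 4 * y%:R - z%:R - l%:R * x%:R in
    let v : R := 8 * x%:R + 5 * y%:R - z%:R - l%:R * y%:R in
    let w : R := 18 * x%:R + 4 * y%:R - l%:R * z%:R in
    (0 < x + y + z)%N -> [/\ 0 <= u, 0 <= v & 0 <= w] ->
    [/\ x%:R * u = 0, y%:R * v = 0 & z%:R * w = 0] ->
    pareto_spectrum (extremal_matrix R) l%:R.
  move=> u v w xyz uvw0 cs; apply/pareto_eigenvalue3P.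
  exists x%:R, y%:R, z%:R => /=; rewrite !mxE /= !mulN1r mul0r addr0.
  split=> //.
  move=> [/eqP + /eqP + /eqP]; rewrite !pnatr_eq0 => /eqP x0 /eqP y0 /eqP z0.
  by move: xyz; rewrite x0 y0 z0.
move=> _ [n /= n9 <-]; rewrite /f.
do 9?[case: n n9 => [_|n n9] /=]; last by [].
(* Each triple is an eigenvector, in the order of the values of [f]; its nonzero coordinates show
   the type. *)
- by apply: (evec _ 0 1 4)%N => //; split; lra.
- by apply: (evec _ 1 1 11)%N => //; split; lra.
- by apply: (evec _ 1 0 6)%N => //; split; lra.
- by apply: (evec _ 0 1 1)%N => //; split; lra.
- by apply: (evec _ 0 1 0)%N => //; split; lra.
- by apply: (evec _ 1 0 3)%N => //; split; lra.
- by apply: (evec _ 1 0 0)%N => //; split; lra.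
- by apply: (evec _ 1 1 2)%N => //; split; lra.
- by apply: (evec _ 1 1 0)%N => //; split; lra.
Qed.

Theorem theorem4p2 (R : realType) : is_pareto_capacity R 3 9.
Proof.
split; last exact: pareto_spectrum3_card_le.
exists (extremal_matrix R); rewrite card_eq_le pareto_spectrum3_card_le.
exact: II9_le_extremal_spectrum.
Qed.
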